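(* Let $n\ge 1$ be an integer and let $a(s)=s^n+a_1s^{n-1}+\cdots+a_n\in H^n$ be a monic real Hurwitz stable polynomial of order $n$. If $(x_1,x_2,\dots,x_{n-1})\in\Omega^W_{1a}$, then for all sufficiently small $\varepsilon>0$ (that is, there is $\varepsilon_0>0$ such that for every $0<\varepsilon<\varepsilon_0$) we have $(x_1-\varepsilon,x_2-\varepsilon,\dots,x_{n-1}-\varepsilon)\in\Omega^W_{1a}$.
   Context: $P^n$ denotes the set of real polynomials of order (exact degree) $n$. $H^n\subset P^n$ denotes the set of Hurwitz stable polynomials of order $n$ (all roots have negative real part). A rational function $p(s)=b(s)/a(s)$ is called weak strictly positive real (WSPR), of order $n$, if $b\in P^{n-1}$, $a\in H^n$, and $\mathrm{Re}[p(j\omega)]>0$ for all $\omega\in\mathbb{R}$, where $j$ is the imaginary unit. For a monic $a\in H^n$, $\Omega^W_{1a}$ is the set of all $(x_1,x_2,\dots,x_{n-1})\in\mathbb{R}^{n-1}$ such that, with $b(s)=s^{n-1}+x_1s^{n-2}+\cdots+x_{n-1}$, the rational function $b(s)/a(s)$ is WSPR. *)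

(* Defs.v *)
From mathcomp Require Import all_boot all_order all_algebra.
From mathcomp Require Import classical_sets reals.
From mathcomp Require Import complex.
Set Implicit Arguments.
Unset Strict Implicit.
Unset Printing Implicit Defensive.
Import Order.TTheory GRing.Theory Num.Theory.
Local Open Scope ring_scope.
Local Open Scope complex_scope.
Local Open Scope classical_set_scope.

(* R : realType is an arbitrary model of the real numbers. *)

Definition poly_of_order (R : realType) (n : nat) : set {poly R} :=
  [set p | size p = n.+1].

Definition polyC_of (R : realType) (p : {poly R}) : {poly R[i]} :=
  map_poly (real_complex R) p.

Definition hurwitz (R : realType) (n : nat) : set {poly R} :=
  [set p | poly_of_order n p /\
           forall z : R[i], root (polyC_of p) z -> complex.Re z < 0].

(* Value of b/a at a complex point.  Division is total, with value 0 where a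
   vanishes; this is harmless below since a Hurwitz denominator has no zero on
   the imaginary axis. *)
Definition ratfun_eval (R : realType) (b a : {poly R}) (z : R[i]) : R[i] :=
  (polyC_of b).[z] / (polyC_of a).[z].

(* The rational function is given by its numerator and denominator (no
   coprimality is required).  Meaningful for n >= 1, because of n.-1. *)
Definition wspr (R : realType) (n : nat) (b a : {poly R}) : Prop :=
  [/\ poly_of_order n.-1 b,
      hurwitz n a &
      forall w : R, 0 < complex.Re (ratfun_eval b a (0 +i* w))].

(* s^(n-1) + x_1 s^(n-2) + ... + x_(n-1): the entry x 0 i is x_(i+1), the
   coefficient of s^(n-1-(i+1)). *)
Definition monic_numerator (R : realType) (n : nat) (x : 'rV[R]_n.-1) :
    {poly R} :=
  'X^(n.-1) + \sum_(i < n.-1) x 0 i *: 'X^(n.-1 - i.+1).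

Definition OmegaW1 (R : realType) (n : nat) (a : {poly R}) :
    set 'rV[R]_n.-1 :=
  [set x | wspr n (monic_numerator x) a].
Arguments OmegaW1 {R} n a.

(* Main.v *)
Require Import Defs.
From mathcomp Require Import all_boot all_order all_algebra.
From mathcomp Require Import classical_sets reals.
From mathcomp Require Import complex polyrcf topology normedtype derive.
From mathcomp Require Import ring lra.
Import Order.TTheory GRing.Theory Num.Theory numFieldNormedType.Exports.
Local Open Scope ring_scope.

(* On the imaginary axis [Re (b/a)] has the sign of [Re (b(jw) a(-jw))], which
   is a polynomial in [t = w^2 >= 0].  Lowering every [x_i] by [eps] adds to it
   [eps] times a polynomial in [t] with positive leading coefficient: this helps
   for large [t], and on the remaining compact interval the original polynomial
   has a positive minimum, which dominates the perturbation for small [eps]. *)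

(** Odd size means even degree, so the top coefficient sits at an even index and survives in the
    even part. *)
Lemma lead_coef_even_poly (R : nzRingType) (p : {poly R}) :
  odd (size p) -> lead_coef (even_poly p) = lead_coef p.
Proof.
move=> odd_p; rewrite !lead_coefE coef_even_poly size_even_poly_eq//.
by rewrite uphalf_half odd_p -[in RHS](odd_double_half (size p)) odd_p.
Qed.

Lemma pos_horner_perturb (R : realType) (f q : {poly R}) :
    (forall t, 0 <= t -> 0 < f.[t]) -> 0 < lead_coef q ->
  exists eps0 : R, 0 < eps0 /\
    forall eps, 0 < eps < eps0 -> forall t, 0 <= t -> 0 < (f + eps *: q).[t].
Proof.
move=> f_gt0 lq_gt0; have [M qM] := poly_pinfty_gt_lc lq_gt0.
(* [M] may be negative; the maximum with 0 keeps the compact interval nonempty. *)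
have M0_ge0 : 0 <= Num.max 0 M by rewrite le_max lexx.
have minp (p : {poly R}) : exists2 c, c \in `[0, Num.max 0 M] &
    forall t, t \in `[0, Num.max 0 M] -> p.[c] <= p.[t].
  apply: EVT_min => //; apply: continuous_subspaceT; exact: continuous_horner.
have [c c_itv fc] := minp f; have [d _ qd] := minp q.
have fc_gt0 : 0 < f.[c] by apply: f_gt0; move: c_itv; rewrite in_itv => /andP[].
have K_gt0 : 0 < `|q.[d]| + 1 by rewrite ltr_wpDl.
(* On the interval [f] is at least [f.[c]] and [q] at least minus the absolute value of [q.[d]], so
   this bound leaves a sum above [eps]. The added 1 covers [q.[d] = 0]. *)
exists (f.[c] / (`|q.[d]| + 1)); split; first exact: divr_gt0.
move=> eps /andP[eps_gt0]; rewrite ltr_pdivlMr// => epsK t t_ge0.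
rewrite hornerD hornerZ; have [tM|Mt] := leP t (Num.max 0 M); last first.
  rewrite addr_gt0 ?f_gt0// mulr_gt0// (lt_le_trans lq_gt0)// qM//.
  by rewrite (le_trans _ (ltW Mt))// le_max lexx orbT.
have t_itv : t \in `[0, Num.max 0 M]%R by rewrite in_itv/= t_ge0.
have fct := fc _ t_itv; have qdt := qd _ t_itv.
have : - `|q.[d]| <= q.[t] by rewrite (le_trans _ qdt)// lerNl -normrN ler_norm.
rewrite -(ler_pM2l eps_gt0); lra.
Qed.

Section ImaginaryAxis.
Variable R : realType.
Implicit Types (a b p q : {poly R}) (w : R).

(** The quotient is [z1 * conjc z2] divided by the positive real [x2 ^+ 2 + y2 ^+ 2]. *)
Lemma Re_div_gt0 (z1 z2 : R[i]) : z2 != 0 ->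
  (0 < complex.Re (z1 / z2)) = (0 < complex.Re (z1 * conjc z2)).
Proof.
case: z1 z2 => [x1 y1] [x2 y2]; rewrite eq_complex/= => nz.
have n_gt0 : 0 < x2 ^+ 2 + y2 ^+ 2.
  rewrite lt_neqAle addr_ge0 ?sqr_ge0// eq_sym paddr_eq0 ?sqr_ge0//.
  by rewrite !sqrf_eq0 nz.
have -> : x1 * (x2 / (x2 ^+ 2 + y2 ^+ 2)) - y1 * - (y2 / (x2 ^+ 2 + y2 ^+ 2)) =
          (x1 * x2 - y1 * - y2) / (x2 ^+ 2 + y2 ^+ 2) by ring.
by rewrite pmulr_lgt0// invr_gt0.
Qed.

Lemma polyC_of_comp p q : polyC_of (p \Po q) = polyC_of p \Po polyC_of q.
Proof. exact: map_comp_poly. Qed.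

Lemma conj_horner_imag p w :
  conjc (polyC_of p).[0 +i* w]%C = (polyC_of (p \Po - 'X)).[0 +i* w]%C.
Proof.
rewrite polyC_of_comp horner_comp /polyC_of rmorphN/= map_polyX hornerN hornerX.
rewrite -horner_map/= -map_poly_comp.
have -> : (0 -i* w)%C = - (0 +i* w)%C.
  by apply/eqP; rewrite eq_complex/= oppr0 !eqxx.
congr (_.[_]); apply: eq_map_poly => x /=; exact: conjc_real.
Qed.

(** Split p(s) = e(s^2) + s o(s^2). At s = jw the square is the real number -w^2, so the odd part
    contributes only to the imaginary part. *)
Lemma Re_horner_imag p w :
  complex.Re (polyC_of p).[0 +i* w]%C = (even_poly p \Po - 'X).[w ^+ 2].
Proof.
have sqi : (0 +i* w)%C ^+ 2 = real_complex R (- w ^+ 2).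
  by apply/eqP; rewrite eq_complex/= !(mul0r, mulr0, add0r, addr0, sub0r) !eqxx.
rewrite -{1}[p]poly_even_odd /polyC_of rmorphD rmorphM/= !map_comp_poly.
rewrite map_polyX map_polyXn hornerD hornerM !horner_comp hornerX hornerXn sqi.
rewrite !horner_map hornerN hornerX /=.
ring.
Qed.

Lemma wspr_Re_gt0 (n : nat) a b w : hurwitz n a ->
  (0 < complex.Re (ratfun_eval b a (0 +i* w)%C)) =
  (0 < (even_poly (b * (a \Po - 'X)) \Po - 'X).[w ^+ 2]).
Proof.
move=> [_ a_root]; rewrite /ratfun_eval Re_div_gt0; last first.
  by apply/negP => /a_root; rewrite ltxx.
by rewrite conj_horner_imag -Re_horner_imag /polyC_of rmorphM hornerM.
Qed.

End ImaginaryAxis.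

Lemma size_monic_numerator (R : realType) (n : nat) (x : 'rV[R]_n.-1) :
  size (monic_numerator x) = n.-1.+1.
Proof.
rewrite /monic_numerator size_polyDl size_polyXn// ltnS.
apply: (leq_trans (size_sum _ _ _)); apply/bigmax_leqP => i _.
rewrite (leq_trans (size_scale_leq _ _))// size_polyXn.
by rewrite -subSn ?subSS ?leq_subr.
Qed.

Lemma monic_numerator_subr (R : realType) (n : nat) (x : 'rV[R]_n.-1) eps :
  monic_numerator (\row_(i < n.-1) (x 0 i - eps)) =
  monic_numerator x - eps *: \poly_(i < n.-1) 1.
Proof.
rewrite /monic_numerator -addrA; congr (_ + _).
(* The numerator lists coefficients from the highest power down, [\poly] from the lowest up;
   reversing the index aligns them. *)
rewrite poly_def [X in _ - _ *: X](reindex_inj rev_ord_inj)/=.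
rewrite scaler_sumr -sumrB.
by apply: eq_bigr => i _; rewrite mxE scale1r scalerBl.
Qed.

Theorem theorem3 (R : realType) (n : nat) (hn : (1 <= n)%N)
    (a : {poly R}) (ha_monic : a \is monic) (ha : hurwitz n a)
    (x : 'rV[R]_n.-1) (hx : OmegaW1 n a x) :
  exists eps0 : R, 0 < eps0 /\
    forall eps : R, 0 < eps < eps0 ->
      OmegaW1 n a (\row_(i < n.-1) (x 0 i - eps)).
Proof.
case: n hn => [//|[|n]] _ in ha x hx *.
  (* In order 1 the row is empty, so the shift changes nothing and any bound will do. *)
  exists 1; split=> // eps _; suff -> : \row_i (x 0 i - eps) = x by [].
  by apply/rowP => -[].
have [_ _ hx_gt0] := hx.
have size_a : size a = n.+3 by case: ha.
(* [r b] is Re (b(jw) a(-jw)) as a polynomial in t = w^2. *)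
set r := fun b => even_poly (b * (a \Po - 'X)) \Po - 'X.
set u : {poly R} := \poly_(i < n.+1) 1.
have size_NX : size (- 'X : {poly R}) = 2 by rewrite size_polyN size_polyX.
have size_u : size u = n.+1 by rewrite size_poly_eq ?oner_neq0.
have lead_u : lead_coef u = 1 by rewrite lead_coef_poly// oner_neq0.
have size_aN : size (a \Po - 'X) = n.+3 by rewrite size_comp_poly2.
(* The degrees n and n + 2 add up to an even number, so the leading term of the product lies in its
   even part. *)
have size_ua : size (u * (a \Po - 'X)) = n.+1.*2.+1.
  by rewrite size_mul -?size_poly_gt0 ?size_u ?size_aN// addSnnS -addnn !addnS.
(* With the order written [n + 2], the signs are [-1] from [- u], [(-1)^(n+2)]
   from [a \Po - 'X] and [(-1)^(n+1)] from the outer [\Po - 'X]. *)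
have lead_ru : lead_coef (r (- u)) = 1.
  rewrite /r lead_coef_comp ?size_NX// lead_coef_even_poly mulNr.
    rewrite size_even_poly_eq size_polyN size_ua /= ?odd_double// half_double.
    rewrite lead_coefN lead_coefM lead_u mul1r lead_coef_comp ?size_NX// size_a.
    rewrite (monicP ha_monic) mul1r lead_coefN lead_coefX -signr_odd/=.
    by rewrite -[in X in _ * X]signr_odd /=; case: (odd n);
      rewrite !(expr0, expr1, mulrN1, mulr1, opprK).
  by rewrite size_polyN size_ua/= odd_double.
have f_gt0 t : 0 <= t -> 0 < (r (monic_numerator x)).[t].
  move=> t_ge0; rewrite -(sqr_sqrtr t_ge0) -(wspr_Re_gt0 _ _ _ _ _ ha).
  exact: hx_gt0.
have lru_gt0 : 0 < lead_coef (r (- u)) by rewrite lead_ru.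
have [e0 [e0_gt0 He0]] := pos_horner_perturb _ _ _ f_gt0 lru_gt0.
exists e0; split=> // eps eps_lt; split=> [|//|w].
  exact: size_monic_numerator.
rewrite (wspr_Re_gt0 _ _ _ _ _ ha) monic_numerator_subr -/u -/(r _).
have := He0 _ eps_lt _ (sqr_ge0 w).
suff -> : r (monic_numerator x - eps *: u) =
          r (monic_numerator x) + eps *: r (- u) by [].
(* [r] is linear: product with a fixed factor, even part and substitution of [- 'X] all are. *)
rewrite /r -scalerN mulrDl -scalerAl.
by rewrite even_polyD even_polyZ comp_polyD comp_polyZ.
Qed.
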